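(* If $\mathfrak{c}\leq\aleph_{\omega+1}$, then every regular countable crowded space has far points.
   Context: All spaces are Tychonoff (in particular Hausdorff). $\mathfrak{c}=2^{\aleph_0}$. A space is crowded if it is non-empty and has no isolated points. $\beta X$ is the Čech–Stone compactification of $X$. A far point of $X$ is a point $p\in\beta X\setminus X$ such that $p\notin\mathrm{cl}_{\beta X}(D)$ for every closed discrete subset $D$ of $X$. *)

(* Defs.v *)
From mathcomp Require Import all_boot all_order all_algebra.
From mathcomp Require Import all_classical all_reals all_analysis.

Set Implicit Arguments.
Unset Strict Implicit.
Unset Printing Implicit Defensive.

Import Order.TTheory GRing.Theory Num.Theory.
Import numFieldNormedType.Exports.

Local Open Scope classical_set_scope.
Local Open Scope card_scope.
Local Open Scope ring_scope.

(** Cardinals are represented by types, compared with [#<=]. *)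

Definition card_lt (S T : Type) : Prop :=
  [set: S] #<= [set: T] /\ ~~ ([set: T] #<= [set: S]).

Definition least_infinite_above (I : Type) (F : I -> Type) (K : Type) : Prop :=
  [/\ infinite_set [set: K],
      forall i, card_lt (F i) K
    & forall L : Type, infinite_set [set: L] ->
        (forall i, card_lt (F i) L) -> [set: K] #<= [set: L]].

(** By recursion on the ordinal a, aleph_a is the least infinite cardinal
    greater than every aleph_b with b < a. The ordinal n is represented by
    ['I_n], omega by [nat], and omega + 1 by [option nat] ([None] being the
    ordinal omega). *)

Definition is_aleph_fin (A : nat -> Type) : Prop :=
  forall n, least_infinite_above (fun i : 'I_n => A i) (A n).

Definition is_aleph_omega_succ (K : Type) : Prop :=
  exists (A : nat -> Type) (W : Type),
    [/\ is_aleph_fin A,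
        least_infinite_above A W
      & least_infinite_above (oapp A W) K].

Definition continuum_le_aleph_omega_succ : Prop :=
  exists K : Type,
    is_aleph_omega_succ K /\ [set: nat -> bool] #<= [set: K].

Definition crowded (X : topologicalType) : Prop :=
  [set: X] !=set0 /\ isolated [set: X] = set0.

Definition closed_discrete (X : topologicalType) (D : set X) : Prop :=
  closed D /\ D `<=` isolated D.

(** The Cech-Stone compactification of a Tychonoff space [X] is the closure of
    the image of [X] under the evaluation map into the cube indexed by all
    continuous functions from [X] to [0, 1]. The factors are taken to be [R]
    instead of [0, 1]: this gives the same closure, with the same subspace
    topology, since the cube is a closed subspace of the power of [R]. *)

Section StoneCech.
Variables (R : realType) (X : topologicalType).

Definition unit_interval_maps : set (X -> R) :=
  [set f : X -> R | continuous f /\ forall x, 0 <= f x <= 1].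

Definition evaluation : X -> prod_topology (fun _ : unit_interval_maps => R) :=
  join_product (fun f : unit_interval_maps => set_val f).

Definition stone_cech : topologicalType :=
  initial_topology
    (set_val : closure (range evaluation) ->
               prod_topology (fun _ : unit_interval_maps => R)).

Definition stone_cech_unit (x : X) : stone_cech :=
  SigSub (mem_set (subset_closure (imageT evaluation x))).

Definition far_point (p : stone_cech) : Prop :=
  ~ range stone_cech_unit p /\
  forall D : set X, closed_discrete D -> ~ closure (stone_cech_unit @` D) p.

End StoneCech.

(* Main.v *)
(** Every closed discrete set has to be missed by a clopen set, in such a way
    that the chosen clopen sets have the finite intersection property. Call a
    family of nonempty open sets avoidable at [x] if some neighbourhood of [x]
    contains none of its members: this holds for all families of size at most
    aleph_n iff the pi-character of [x] exceeds aleph_n. If a family is avoidable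
    at each point of a closed discrete set [D], then some clopen set missing [D]
    meets all of its members.

    Suppose first that the points of pi-character at most aleph_n are dense in
    some open set, and let [n] be least. Then a smaller open set has a pi-base of
    size aleph_n, while families of size less than aleph_n are avoidable at all of
    its points. As aleph_n is regular, van Douwen's construction of remote points
    of metrizable spaces goes through with aleph_n in place of omega.

    Otherwise there is a partition of the space in clopen sets C_n, and nonempty
    clopen sets V_n in C_n all of whose points have pi-character greater than
    aleph_n. The at most aleph_(omega+1) closed discrete sets are treated one by
    one: at each stage there are at most aleph_omega finite intersections of
    earlier sets, and those of the first aleph_n ones that meet V_n can be met by
    the new set inside V_n. *)

Require Import Defs.
From mathcomp Require Import all_boot all_order all_algebra.
From mathcomp Require Import all_classical all_reals all_analysis.
From mathcomp Require wochoice.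

Set Implicit Arguments.
Unset Strict Implicit.
Unset Printing Implicit Defensive.

Import Order.TTheory GRing.Theory Num.Theory.
Import numFieldNormedType.Exports.

Local Open Scope classical_set_scope.
Local Open Scope card_scope.

(** * Cardinals and well-orders *)

Lemma card_le_of_inj (T U : Type) (A : set T) (B : set U) (f : T -> U) :
  set_fun A B f -> set_inj A f -> A #<= B.
Proof.
move=> fAB finj; have /injfunPex[g] := ex_intro2 _ _ f fAB finj.
exact: inj_card_le g.
Qed.

Lemma card_le_fun (T U : Type) (A : set T) (B : set U) (u : U) :
  A #<= B -> exists2 f : T -> U, set_fun A B f & set_inj A f.
Proof.
elim/Ppointed: U u B => U u B; first by case: (no u).
by move/pcard_leP/injfunPex.
Qed.

Lemma card_leT_inj (T U : Type) :
  [set: T] #<= [set: U] -> exists f : T -> U, injective f.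
Proof.
have [[u]|nU] := pselect (inhabited U).
  by move=> /(card_le_fun u)[f _ finj]; exists f => x y; apply: finj; rewrite inE.
have U0 : [set: U] = set0 by rewrite -subset0 => v _; apply: nU; exists.
rewrite U0 card_le0 => /eqP TE.
have T0 (t : T) : False by have : [set: T] t by []; rewrite TE.
by exists (fun t => False_rect _ (T0 t)) => t; case: (T0 t).
Qed.

(** Zorn's lemma yields a maximal graph of a partial injection; were it neither total nor
    surjective, one more pair could be added. *)
Lemma card_le_totalT (T U : Type) :
  [set: T] #<= [set: U] \/ [set: U] #<= [set: T].
Proof.
pose P (G : set (T * U)) :=
  forall p q, G p -> G q -> (p.1 = q.1 <-> p.2 = q.2).
have [F FP Ftot|G [PG Gmax]] := @Zorn_bigcup _ P.
  move=> p q [X FX Xp] [Y FY Yq].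
  by have [XY|YX] := Ftot _ _ FX FY;
    [apply: (FP _ FY) => //; exact: XY|apply: (FP _ FX) => //; exact: YX].
have [Gtot|/existsNP[t Gt]] := pselect (forall t, exists u, G (t, u)).
  have [f Gf] := choice Gtot; left; apply: (@card_le_of_inj _ _ _ _ f) => //.
  by move=> x y _ _ fxy; apply/(PG (x, f x) (y, f y)).
have [Gtot|/existsNP[u Gu]] := pselect (forall u, exists t, G (t, u)).
  have [f Gf] := choice Gtot; right; apply: (@card_le_of_inj _ _ _ _ f) => //.
  by move=> x y _ _ fxy; apply/(PG (f x, x) (f y, y)).
exfalso; apply: (Gmax (G `|` [set (t, u)])).
  split; first by left.
  by move=> /(_ (t, u) (or_intror erefl)) Gtu; apply: Gt; exists u.
move=> [x y] [x' y'] /= [Gp|[-> ->]] [Gq|[-> ->]] //; first exact: (PG _ _ Gp Gq).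
- by split=> E; subst; [case: Gt; exists y|case: Gu; exists x].
- by split=> E; subst; [case: Gt; exists y'|case: Gu; exists x'].
Qed.

Record well_order (T : Type) (lt : T -> T -> Prop) : Prop := WellOrder {
  wo_wf : well_founded lt;
  wo_trans : forall x y z, lt x y -> lt y z -> lt x z;
  wo_total : forall x y, [\/ lt x y, x = y | lt y x] }.

Lemma wo_min (T : Type) (lt : T -> T -> Prop) (P : set T) : well_order lt ->
  P !=set0 -> exists2 x, P x & forall y, lt y x -> ~ P y.
Proof.
move=> [wf _ _] [x Px]; apply: contrapT => nmin.
elim/(well_founded_ind wf): x Px => x IH Px; apply: nmin.
by exists x => // y /IH.
Qed.

Lemma wo_irrefl (T : Type) (lt : T -> T -> Prop) x : well_order lt -> ~ lt x x.
Proof.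
by move=> wo xx; have [|y -> /(_ _ xx)] := wo_min (P := [set x]) wo; [exists x|apply].
Qed.

(** Here and below, [~ lt y x] plays the role of the reflexive order: [x] is at most [y]. *)
Lemma wo_le_trans (I : Type) (lt : I -> I -> Prop) x y z : well_order lt ->
  ~ lt y x -> ~ lt z y -> ~ lt z x.
Proof.
move=> wo yx zy zx; have [xy|E|//] := wo_total wo x y.
  by apply: zy; exact: wo_trans zx xy.
by apply: zy; rewrite -E.
Qed.

Lemma wo_le_max (I : Type) (lt : I -> I -> Prop) x y : well_order lt ->
  exists z, ~ lt z x /\ ~ lt z y.
Proof.
move=> wo; have irr z := @wo_irrefl _ _ z wo.
have [xy|->|yx] := wo_total wo x y.
- by exists y; split=> // yx; apply: (irr x); exact: wo_trans xy yx.
- by exists y.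
- by exists x; split=> // xy; apply: (irr x); exact: wo_trans xy yx.
Qed.

Lemma wo_seq_max (T : eqType) (I : Type) (lt : I -> I -> Prop) (h : T -> I) l :
  well_order lt -> l <> [::] :> seq T ->
  exists l1 t l2, l = l1 ++ t :: l2 /\ forall t', t' \in l -> ~ lt (h t) (h t').
Proof.
move=> wo; elim: l => // t l IH _.
have irr z := @wo_irrefl _ _ z wo.
have [->|/eqP/IH[l1 [u [l2 [lE um]]]]] := eqVneq l [::].
  by exists [::], t, [::]; split=> // t'; rewrite inE => /eqP->.
have [tu|ntu] := pselect (lt (h u) (h t)).
  exists [::], t, l; split=> // t'; rewrite inE => /predU1P[->//|/um ut'].
  by apply: (wo_le_trans wo ut') => ltt; apply: (irr (h u)); exact: wo_trans tu ltt.
exists (t :: l1), u, l2; split; first by rewrite lE.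
by move=> t'; rewrite inE => /predU1P[->//|]; exact: um.
Qed.

(** The library provides a relation for which every nonempty predicate has a unique minimum. Minima
    of pairs give antisymmetry and totality, those of triples give transitivity, and the strict part
    is well-founded. *)
Lemma well_order_exists (T : Type) : exists lt : T -> T -> Prop, well_order lt.
Proof.
elim/Peq: T => T; have [R Rwo] := wochoice.well_ordering_principle T.
have Rmin (P : set T) : P !=set0 -> exists2 x, P x & forall y, P y -> R x y.
  move=> [x Px]; have [|z [[Pz zmin] _]] := Rwo (mem P).
    by exists x; apply/mem_set.
  by exists z => [|y Py]; [exact: set_mem|apply: zmin; apply/mem_set].
have Ranti x y : R x y -> R y x -> x = y.
  move=> xy yx; have [|z [_ zuniq]] := Rwo (mem [set x; y]).
    by exists x; apply/mem_set; left.
  have Rr u : R u u by have [|v -> /(_ u)] := Rmin [set u]; [exists u|apply].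
  rewrite -(zuniq x); last first.
    by split=> [|u /set_mem[->|->]//]; apply/mem_set; left.
  by apply: zuniq; split=> [|u /set_mem[->|->]//]; apply/mem_set; right.
have Rtot x y : R x y \/ R y x.
  have [|z [->|->] zm] := Rmin [set x; y]; first by exists x; left.
    by left; apply: zm; right.
  by right; apply: zm; left.
pose lt x y := R x y /\ x <> y.
have wf : well_founded lt.
  move=> x; apply: contrapT => nx.
  have [|z nz zmin] := Rmin [set u | ~ Acc lt u]; first by exists x.
  apply: nz; constructor => y [yz ynz]; apply: contrapT => ny.
  by apply: ynz; apply: Ranti => //; exact: zmin.
exists lt; split=> //.
  move=> x y z [xy xny] [yz ynz].
  have [|u ou um] := Rmin [set x; y; z]; first by exists x; left; left.
  have ux : u = x.
    case: ou => [[//|/= E]|/= E]; subst u.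
      by apply: Ranti => //; apply: um; left; left.
    by case: ynz; apply: Ranti => //; apply: um; left; right.
  subst u; split; first by apply: um; right.
  by move=> E; subst z; apply: xny; exact: Ranti.
move=> x y; have [->|/eqP xny] := eqVneq x y; first exact: Or32.
by have [xy|yx] := Rtot x y; [apply: Or31|apply: Or33]; split=> //; exact: nesym.
Qed.

(* The order type of this well-order is the initial ordinal of [T]. *)
Lemma initial_well_order (T : Type) : exists lt : T -> T -> Prop,
  well_order lt /\ forall x, ~ ([set: T] #<= [set y | lt y x]).
Proof.
have [lt lt_wo] := well_order_exists T.
have [nbig|/existsNP[x0 /contrapT Tx0]] :=
  pselect (forall x, ~ ([set: T] #<= [set y | lt y x])); first by exists lt.
have [x Tx xmin] := wo_min lt_wo
  (ex_intro [set x | [set: T] #<= [set y | lt y x]] x0 Tx0).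
have [f ffun finj] : exists2 f : T -> T, forall t, lt (f t) x & injective f.
  have [f fx finj] := card_le_fun x Tx.
  by exists f => [t|u v]; [exact: fx|apply: finj; rewrite inE].
(* The order is pulled back along an injection of [T] into its shortest initial segment of full
   size. *)
exists (fun u v => lt (f u) (f v)); split; first split.
- have := wo_wf lt_wo; move=> wf u; move: {2}(f u) (erefl (f u)) => w.
  elim/(well_founded_ind wf): w u => w IH u fu; constructor => v vu.
  by apply: (IH (f v)) => //; rewrite -fu.
- by move=> u v w; exact: wo_trans.
- move=> u v; have [h|/finj h|h] := wo_total lt_wo (f u) (f v);
  [exact: Or31|exact: Or32|exact: Or33].
- move=> u Tu; apply: (xmin (f u)) => //=; apply: (card_le_trans Tu).
  by apply: (@card_le_of_inj _ _ _ _ f) => // a b _ _ /finj.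
Qed.

Lemma card_le_total (T U : Type) (A : set T) (B : set U) : A #<= B \/ B #<= A.
Proof.
have AT := card_setT A; have BT := card_setT B.
have [AB|BA] := card_le_totalT A B; [left|right].
  by rewrite -(card_le_eql AT) -(card_le_eqr BT).
by rewrite -(card_le_eql BT) -(card_le_eqr AT).
Qed.

Lemma infinite_nat_inj (T : Type) : infinite_set [set: T] ->
  exists e : nat -> T, injective e.
Proof. by move/infiniteP/card_leT_inj. Qed.

(** * Squares and finite sequences over infinite sets *)

Section Square.
Variable T : Type.

Let dom (G : set (T * T * T)) : set T := [set x | exists z, G ((x, x), z)].

(* [G] is the graph of an injection of [dom G `*` dom G] into [dom G]. *)
Definition pairing_graph (G : set (T * T * T)) : Prop :=
  [/\ forall x y, dom G x -> dom G y -> exists z, G ((x, y), z),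
      forall x y z, G ((x, y), z) -> [/\ dom G x, dom G y & dom G z]
    & forall p q, G p -> G q -> (p.1 = q.1 <-> p.2 = q.2)].

Let pairing_graph_bigcup (F : set (set (T * T * T))) :
  F `<=` pairing_graph -> total_on F subset ->
  pairing_graph (\bigcup_(G in F) G).
Proof.
move=> FP Ftot.
have domS G H : G `<=` H -> dom G `<=` dom H by move=> GH x [z /GH]; exists z.
have join p q : (\bigcup_(G in F) G) p -> (\bigcup_(G in F) G) q ->
    exists G, [/\ F G, G p & G q].
  move=> [G FG Gp] [H FH Hq]; have [GH|HG] := Ftot _ _ FG FH.
    by exists H; split=> //; exact: GH.
  by exists G; split=> //; exact: HG.
split.
- move=> x y [z zx] [w wy]; have [G [FG Gz Gw]] := join _ _ zx wy.
  have [tot _ _] := FP _ FG; have [||v Gv] := tot x y; [by exists z|by exists w|].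
  by exists v; exists G.
- move=> x y z [G FG Gp]; have [_ + _] := FP _ FG; move=> /(_ _ _ _ Gp)[? ? ?].
  by split; apply: (domS G) => //; exact: bigcup_sup.
- by move=> p q Fp Fq; have [G [FG Gp Gq]] := join _ _ Fp Fq;
    have [_ _] := FP _ FG; apply.
Qed.

(** [G0] is a copy of the pairing on [nat]. Zorn's lemma is applied to the [G] whose union with [G0]
    is a pairing graph, so that the empty chain is covered and the domain obtained is infinite. *)
Lemma maximal_pairing_graph : infinite_set [set: T] ->
  exists G, [/\ pairing_graph G, infinite_set (dom G)
    & forall H, G `<` H -> ~ pairing_graph H].
Proof.
move=> /infinite_nat_inj[e einj].
pose G0 : set (T * T * T) :=
  [set p | exists i j, p = ((e i, e j), e (pickle (i, j)))].
have pinj : injective (@pickle (nat * nat)%type) by apply: pcan_inj; exact: pickleK.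
have G0P : pairing_graph G0.
  have dG i : dom G0 (e i) by exists (e (pickle (i, i))), i, i.
  split.
  - by move=> x y [z [i [_ [-> _ _]]]] [w [j [_ [-> _ _]]]];
      exists (e (pickle (i, j))), i, j.
  - by move=> x y z [i [j [-> -> ->]]].
  - move=> p q [i [j ->]] [k [l ->]] /=; split=> [[/einj-> /einj->]//|].
    by move=> /einj/pinj[-> ->].
have [F FP Ftot|G [PG Gmax]] := @Zorn_bigcup _ [set G | pairing_graph (G `|` G0)].
  have [->|/set0P[G FG]] := eqVneq F set0.
    by rewrite bigcup_set0 /= set0U.
  rewrite /= -bigcupUl; last by exists G.
  rewrite -(bigcup_image F (fun G => G `|` G0) id).
  apply: pairing_graph_bigcup.
    by move=> _ [H FH <-]; exact: FP.
  move=> _ _ [H FH <-] [H' FH' <-].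
  by have [h|h] := Ftot _ _ FH FH'; [left|right]; exact: setSU.
exists (G `|` G0); split=> //.
  apply: (@sub_infinite_set _ (range e)).
    by move=> _ [i _ <-]; exists (e (pickle (i, i))); right; exists i, i.
  apply/infiniteP; apply: (@card_le_of_inj _ _ _ _ e) => [i _|i j _ _ /einj//].
  by exists i.
move=> H [GH HG] PH; apply: (Gmax H); last first.
  by rewrite /= setUidl// => p G0p; apply: GH; right.
split; first by move=> p Gp; apply: GH; left.
by move=> h; apply: HG => p /h; left.
Qed.

(** Let [S] be the domain of a maximal pairing graph. If the complement of [S] embeds in [S], so
    does all of [T]. Otherwise some [h] embeds [S] in its complement, and the graph extends to the
    union of [S] and its image, against maximality. *)
Lemma card_square : infinite_set [set: T] -> [set: T * T] #<= [set: T].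
Proof.
move=> Tinf; have [G [PG domG Gmax]] := maximal_pairing_graph Tinf.
set S := dom G in domG; have [Gtot GS Gbij] := PG.
have [e eS einj] : exists2 e : nat -> T, (forall i, S (e i)) & injective e.
  have [t St] := infinite_setN0 domG.
  have [e eS einj] := card_le_fun t (proj1 (infiniteP S) domG).
  by exists e => [i|i j]; [exact: eS|apply: einj; rewrite inE].
have [g Gg] : exists g : T * T -> T, forall x y, S x -> S y -> G ((x, y), g (x, y)).
  have [p|g gP] := @choice (T * T) T (fun p z => S p.1 -> S p.2 -> G (p, z)).
    have [[x y]|nS] := pselect (S p.1 /\ S p.2); last first.
      by exists p.1 => x y; case: nS.
    by have [z] := Gtot _ _ x y; case: p x y => a b; exists z.
  by exists g => x y; exact: (gP (x, y)).
have Sg x y : S x -> S y -> S (g (x, y)) by move=> Sx Sy; have [] := GS _ _ _ (Gg _ _ Sx Sy).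
have ginj x y x' y' : S x -> S y -> S x' -> S y' ->
    g (x, y) = g (x', y') -> x = x' /\ y = y'.
  move=> Sx Sy Sx' Sy' E.
  by have /= [_ /(_ E)[-> ->]] := Gbij _ _ (Gg _ _ Sx Sy) (Gg _ _ Sx' Sy').
have [CS|SC] := card_le_total (~` S) S.
  have [h hS hinj] := card_le_fun (e 0%N) CS.
  pose phi x := if pselect (S x) then g (x, e 0%N) else g (h x, e 1%N).
  have Sphi x : S (phi x).
    by rewrite /phi; case: pselect => Sx; apply: Sg => //; exact: hS.
  have phi_inj : injective phi.
    move=> x y; rewrite /phi; case: pselect => Sx; case: pselect => Sy.
    - by move=> /ginj[].
    - by move=> /ginj[] //; [exact: hS|move=> _ /einj].
    - by move=> /ginj[] //; [exact: hS|move=> _ /einj].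
    - move=> /ginj[] //; [exact: hS|exact: hS|move=> /hinj + _].
      by apply; rewrite inE.
  apply: (@card_le_of_inj _ _ _ _ (fun p => g (phi p.1, phi p.2))) => //.
  by move=> [a b] [c d] _ _ /= /ginj[] // /phi_inj-> /phi_inj->.
exfalso; have [h hS hinj0] := card_le_fun (e 0%N) SC.
have hinj x y : S x -> S y -> h x = h y -> x = y.
  by move=> Sx Sy; apply: hinj0; rewrite inE.
(* The new pairs form three blocks: the first coordinate stays in [S] for [k = 0], the second for
   [k = 1], neither for [k = 2]. The entry [e k] keeps the codes of different blocks apart. *)
pose al k u := if k == 0%N then u else h u.
pose be k v := if k == 1%N then v else h v.
pose N : set (T * T * T) := [set p | exists k u v, [/\ (k < 3)%N, S u, S v &
  p = ((al k u, be k v), h (g (g (u, v), e k)))]].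
have domN x : dom (G `|` N) x <-> S x \/ exists2 u, S u & x = h u.
  split=> [[z [Gz|[k [u [v [_ Su Sv [-> _ _]]]]]]]|[[z Gz]|[u Su ->]]].
  - by left; exists z.
  - by rewrite /al; case: ifP => _; [left|right; exists u].
  - by exists z; left.
  - by exists (h (g (g (u, u), e 2%N))); right; exists 2%N, u, u.
have hN x y : S x -> S y -> x <> h y by move=> Sx Sy E; apply: (hS y Sy); rewrite -E.
apply: (Gmax (G `|` N)).
  split=> [p|GN]; first by left.
  have /GN/GS[Sh _ _] : (G `|` N) ((h (e 0%N), h (e 0%N)), h (g (g (e 0%N, e 0%N), e 2%N))).
    by right; exists 2%N, (e 0%N), (e 0%N).
  by apply: (hN (h (e 0%N)) (e 0%N)).
split.
- move=> x y /domN[Sx|[u Su ->]] /domN[Sy|[v Sv ->]].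
  + by exists (g (x, y)); left; exact: Gg.
  + by exists (h (g (g (x, v), e 0%N))); right; exists 0%N, x, v.
  + by exists (h (g (g (u, y), e 1%N))); right; exists 1%N, u, y.
  + by exists (h (g (g (u, v), e 2%N))); right; exists 2%N, u, v.
- move=> x y z [/GS[Sx Sy Sz]|[k [u [v [k3 Su Sv [-> -> ->]]]]]].
    by split; apply/domN; left.
  split; apply/domN.
  + by rewrite /al; case: ifP => _; [left|right; exists u].
  + by rewrite /be; case: ifP => _; [left|right; exists v].
  + by right; exists (g (g (u, v), e k)) => //; exact: Sg _ _ (Sg _ _ Su Sv) (eS k).
- have GNN p q : G p -> N q -> p.1 <> q.1 /\ p.2 <> q.2.
    case: p => [[x y] z] /GS[Sx Sy Sz] [k [u [v [k3 Su Sv ->]]]]; split=> /=.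
      move=> [xE yE]; move: xE yE; rewrite /al /be; case: ifP => [/eqP->|_] /=.
        by move=> _; exact: hN.
      by move=> /(hN _ _ Sx Su).
    by apply: hN => //; exact: Sg _ _ (Sg _ _ Su Sv) (eS k).
  move=> p q [Gp|Np] [Gq|Nq].
  + exact: Gbij.
  + by have [? ?] := GNN _ _ Gp Nq.
  + by have [? ?] := GNN _ _ Gq Np; split=> /esym.
  + move: Np Nq => [k [u [v [k3 Su Sv ->]]]] [k' [u' [v' [k'3 Su' Sv' ->]]]] /=.
    split=> [[]|E]; last first.
      have [gE /einj->] := ginj _ _ _ _ (Sg _ _ Su Sv) (eS k) (Sg _ _ Su' Sv')
        (eS k') (hinj _ _ (Sg _ _ (Sg _ _ Su Sv) (eS k))
                          (Sg _ _ (Sg _ _ Su' Sv') (eS k')) E).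
      by have [-> ->] := ginj _ _ _ _ Su Sv Su' Sv' gE.
    rewrite /al /be.
    have [uu vv] : (h u = h u' -> u = u') /\ (h v = h v' -> v = v').
      by split; exact: hinj.
    have [nu nu'] : u <> h u' /\ u' <> h u by split; exact: hN.
    have [nv nv'] : v <> h v' /\ v' <> h v by split; exact: hN.
    case: k k3 => [|[|[|//]]] _; case: k' k'3 => [|[|[|//]]] _ /= E1 E2;
      first [by case: nu | by case: nu' | by case: nv | by case: nv'
        | by rewrite E1 (vv E2) | by rewrite (uu E1) E2
        | by rewrite (uu E1) (vv E2)].
Qed.

End Square.

Lemma card_seq (T : Type) : infinite_set [set: T] -> [set: seq T] #<= [set: T].
Proof.
move=> Tinf; have [e einj] := infinite_nat_inj Tinf.
have [f finj] := card_leT_inj (card_square Tinf).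
pose code := foldr (fun x c => f (x, c)) (e 0%N).
have code_inj s t : size s = size t -> code s = code t -> s = t.
  by elim: s t => [|x s IH] [|y t] //= [st] /finj[-> /(IH _ st)->].
apply: (@card_le_of_inj _ _ _ _ (fun s => f (e (size s), code s))) => //.
by move=> s t _ _ /finj[/einj st]; exact: code_inj.
Qed.

Lemma card_prod_le (S T U : Type) : infinite_set [set: U] ->
  [set: S] #<= [set: U] -> [set: T] #<= [set: U] -> [set: S * T] #<= [set: U].
Proof.
move=> Uinf /card_leT_inj[f finj] /card_leT_inj[g ginj].
apply: (card_le_trans _ (card_square Uinf)).
apply: (@card_le_of_inj _ _ _ _ (fun p => (f p.1, g p.2))) => //.
by move=> [a b] [c d] _ _ [/finj-> /ginj->].
Qed.

(** An infinite [B] that embeds in no [F i] lies strictly above all of them by comparability, so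
    minimality of [K] would embed [K] in [B]. *)
Lemma least_infinite_above_lt (I S : Type) (F : I -> Type) (K : Type)
    (B : set S) : least_infinite_above F K -> ~ ([set: K] #<= B) ->
  finite_set B \/ exists i, B #<= [set: F i].
Proof.
move=> [_ _ Kmin] nKB; have BT := card_setT B.
have [?|Binf] := pselect (finite_set B); first by left.
right; apply: contrapT => /forallNP nB; apply: nKB.
rewrite -(card_le_eqr BT); apply: Kmin.
  by rewrite (eq_finite_set BT).
move=> i; have nBi : ~ ([set: B] #<= [set: F i]).
  by move=> h; apply: (nB i); rewrite -(card_le_eql BT).
by split; [have [] := card_le_totalT (F i) B|exact/negP].
Qed.

(** * The cardinals aleph_n, aleph_omega and aleph_(omega+1) *)

Section Alephs.
Variable A : nat -> Type.
Hypothesis A_aleph : is_aleph_fin A.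

Lemma aleph_infinite n : infinite_set [set: A n].
Proof. by have [] := A_aleph n. Qed.

Lemma aleph_lt i n : (i < n)%N -> card_lt (A i) (A n).
Proof. by move=> lt_in; have [_ + _] := A_aleph n; move/(_ (Ordinal lt_in)). Qed.

Lemma aleph_le i n : (i <= n)%N -> [set: A i] #<= [set: A n].
Proof. by rewrite leq_eqVlt => /predU1P[->//|/aleph_lt[]]. Qed.

Lemma aleph_pred (S : Type) (B : set S) n :
  ~ ([set: A n] #<= B) ->
  if n is m.+1 then B #<= [set: A m] else finite_set B.
Proof.
move=> /(least_infinite_above_lt (A_aleph n))[Bfin|[[i lt_in] /= Bi]].
  by case: n => // n; have [//|/(card_le_finite)] := card_le_total B [set: A n];
    move=> /(_ Bfin)/aleph_infinite.
by case: n lt_in => // m; rewrite ltnS => /aleph_le; exact: card_le_trans.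
Qed.

(** If [f] were unbounded on the segment below [i], the segments below the [f j] would cover [A n].
    For [n = 0] this is a finite union of finite sets; for [n = m.+1] it embeds [A n] in the square
    of [A m], hence in [A m]. *)
Lemma aleph_regular_order n : exists lt : A n -> A n -> Prop,
  [/\ well_order lt,
      forall i, if n is m.+1 then [set j | lt j i] #<= [set: A m]
                else finite_set [set j | lt j i]
    & forall i (f : A n -> A n), exists k, forall j, lt j i -> ~ lt k (f j)].
Proof.
have [lt [lt_wo nle]] := initial_well_order (A n); exists lt.
have seg i := aleph_pred (nle i).
split=> // i f; apply: contrapT => /forallNP unb.
have cover k : exists2 j, lt j i & lt k (f j).
  by have /existsNP[j /not_implyP[ji /contrapT kj]] := unb k; exists j.
case: n => [|m] in lt lt_wo nle seg i f unb cover *.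
  apply: (@aleph_infinite 0); apply: sub_finite_set (bigcup_finite (seg i)
    (fun j _ => seg (f j))) => k _.
  by have [j ? ?] := cover k; exists j.
have [_ /negP] := aleph_lt (ltnSn m); apply.
apply: card_le_trans (card_square (aleph_infinite (n := m))).
have [x] := infinite_setN0 (aleph_infinite (n := m)) => _.
have [g _ ginj] := card_le_fun x (seg i).
have /choice[h hinj] : forall y, exists h : A m.+1 -> A m, {in [set j | lt j y] &, injective h}.
  by move=> y; have [h _ hinj] := card_le_fun x (seg y); exists h.
have /choice[c cP] : forall k, exists j, lt j i /\ lt k (f j).
  by move=> k; have [j ? ?] := cover k; exists j.
apply: (@card_le_of_inj _ _ _ _ (fun k => (g (c k), h (f (c k)) k))) => //.
move=> k l _ _ []; have [ki kc] := cP k; have [li lc] := cP l.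
move=> /ginj; rewrite !inE /= => /(_ ki li) ckl; rewrite -ckl in lc *.
by move/hinj; rewrite !inE; exact.
Qed.

End Alephs.

Section AlephOmega.
Variables (A : nat -> Type) (W K : Type).
Hypothesis A_aleph : is_aleph_fin A.
Hypothesis W_aleph : least_infinite_above A W.
Hypothesis K_aleph : least_infinite_above (oapp A W) K.

(** The disjoint sum lies strictly above each [A n] because it contains [A n.+1]. The tags later cut
    a set of size aleph_omega into countably many pieces, the [n]-th of size at most aleph_n. *)
Lemma aleph_omega_sum : [set: W] #<= [set: {n & A n}].
Proof.
have incl n : [set: A n] #<= [set: {n & A n}].
  apply: (@card_le_of_inj _ _ _ _ (fun a => existT A n a)) => // a b _ _.
  exact: eq_from_Tagged.
have [_ _] := W_aleph; apply.
  by move/(card_le_finite (incl 0%N)); exact: aleph_infinite.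
move=> n; split; first exact: incl.
apply/negP => /(card_le_trans (incl n.+1)).
by have [_ /negP] := aleph_lt A_aleph (ltnSn n).
Qed.

(** In an initial well-order of [T], a segment cannot have size [K]; it is finite or bounded by some
    aleph_n or by aleph_omega, and so embeds in the sum. *)
Lemma aleph_omega_succ_order (T : Type) : [set: T] #<= [set: K] ->
  exists lt : T -> T -> Prop, well_order lt /\
    forall x, [set y | lt y x] #<= [set: {n & A n}].
Proof.
move=> TK; have [lt [lt_wo nle]] := initial_well_order T.
exists lt; split=> // x; have incl n : [set: A n] #<= [set: {n & A n}].
  apply: (@card_le_of_inj _ _ _ _ (fun a => existT A n a)) => // a b _ _.
  exact: eq_from_Tagged.
have [|xfin|[[n|] /= xle]] := least_infinite_above_lt (B := [set y | lt y x]) K_aleph.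
- by move/(card_le_trans TK)/nle.
- have [//|/card_le_finite/(_ xfin)/(card_le_finite (incl 0%N))] :=
    card_le_total [set y | lt y x] [set: {n & A n}].
  by move/(aleph_infinite A_aleph).
- exact: card_le_trans (incl n).
- exact: card_le_trans aleph_omega_sum.
Qed.

End AlephOmega.

(** * Clopen sets in countable regular spaces *)

(** All families indexed by [B] are quantified over, so only the size of [B] matters. Empty members
    are allowed and ignored, which permits cutting a family down by an open set. *)
Definition avoidable (X : topologicalType) (L : Type) (B : set L) (x : X) :=
  forall c : L -> set X, (forall l, open (c l)) ->
    exists2 W, nbhs x W & forall l, B l -> c l !=set0 -> ~ (c l `<=` W).

Lemma avoidableU (X : topologicalType) (L : Type) (B C : set L) (x : X) :
  avoidable B x -> avoidable C x -> avoidable (B `|` C) x.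
Proof.
move=> aB aC c oc; have [W nW WB] := aB c oc; have [W' nW' WC] := aC c oc.
exists (W `&` W'); first exact: filterI.
move=> l [Bl|Cl] cl sub; first by apply: (WB l) => // y /sub[].
by apply: (WC l) => // y /sub[].
Qed.

(** A family over [B] is carried to [C] along an injection, by taking unions over its fibres: each
    is a single member or empty. *)
Lemma avoidable_card_le (X : topologicalType) (L M : Type) (B : set L)
    (C : set M) (x : X) :
  C !=set0 -> B #<= C -> avoidable C x -> avoidable B x.
Proof.
move=> [m _] BC aC c oc; have [f fBC finj] := card_le_fun m BC.
have [|W nW WC] := aC (fun m => \bigcup_(l in B `&` f @^-1` [set m]) c l).
  by move=> m'; apply: bigcup_open => l _; exact: oc.
exists W => // l Bl [y cly] sub; apply: (WC (f l)); first exact: fBC.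
  by exists y, l.
move=> z [l' [Bl' /finj ll']]; rewrite ll' ?inE//; exact: sub.
Qed.

Lemma clopen_glue (X : topologicalType) (iota : X -> nat) (P : nat -> set X) :
  (forall n, open (iota @^-1` [set n])) -> (forall n, clopen (P n)) ->
  clopen [set x | P (iota x) x].
Proof.
move=> oi; have glue Q : (forall n, open (Q n)) -> open [set x | Q (iota x) x].
  move=> oQ; rewrite (_ : mkset _ = \bigcup_n (iota @^-1` [set n] `&` Q n)).
    by apply: bigcup_open => n _; exact: openI.
  by apply/seteqP; split=> [x Qx|x [n _ [/= <-]]//]; exists (iota x).
move=> cP; split; first by apply: glue => n; case: (cP n).
rewrite -openC; apply: (glue (fun n => ~` P n)) => n.
by rewrite openC; case: (cP n).
Qed.

Definition linked (T : eqType) (X : Type) (P : set T) (Phi : T -> set X) (n : nat) :=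
  forall l, (size l <= n)%N -> (forall t, t \in l -> P t) ->
    exists x, forall t, t \in l -> Phi t x.

Section CountableRegular.
Variable X : topologicalType.
Hypothesis X_accessible : accessible_space X.
Hypothesis X_regular : regular_space X.
Variable e : nat -> X.
Hypothesis e_surj : forall x, exists n, e n = x.

Lemma regular_open_nbhs (x : X) (U : set X) : nbhs x U ->
  exists V, [/\ open V, V x & closure V `<=` U].
Proof.
move=> /X_regular[M nM MU]; exists M°; split; first exact: open_interior.
  exact: nbhs_singleton (nbhs_interior nM).
by apply: subset_trans MU; apply: closureS; exact: interior_subset.
Qed.

(* An open partition separating [x] from the complement of [U] is built by
   putting the points of [X] one by one in one of two disjoint open sets. *)
Lemma countable_regular_clopen (x : X) (U : set X) : nbhs x U ->
  exists V, [/\ clopen V, V x & V `<=` U].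
Proof.
move=> nU.
(* Disjointness of the closures keeps the process going: each new point is outside one of them, and
   has a neighbourhood whose closure misses that one. *)
pose sep (p : set X * set X) :=
  [/\ open p.1, open p.2 & closure p.1 `&` closure p.2 = set0].
have grow (P Q : set X) y : sep (P, Q) -> ~ closure Q y ->
    exists P', [/\ sep (P', Q), P `<=` P' & P' y].
  move=> [/= oP oQ PQ] Qy.
  have [N [oN Ny NQ]] : exists V, [/\ open V, V y & closure V `<=` ~` closure Q].
    by apply: regular_open_nbhs; apply: open_nbhs_nbhs; split=> //;
      apply: closed_openC; exact: closed_closure.
  exists (P `|` N); split; [split=> //=|by move=> z; left|by right].
    exact: openU.
  rewrite closureU setIUl PQ set0U -subset0 => z [Nz Qz]; exact: NQ z Nz Qz.
have step n p : exists q, sep p ->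
    [/\ sep q, p.1 `<=` q.1, p.2 `<=` q.2 & (q.1 `|` q.2) (e n)].
  have [sp|nsp] := pselect (sep p); last by exists p.
  case: p sp => P Q sp; have [Qn|nQn] := pselect (closure Q (e n)).
    have [||Q' [[/= oQ oP QP] QQ' Q'n]] := @grow Q P (e n).
    - by case: sp => /= ? ? PQ; split=> //=; rewrite setIC.
    - by move=> Pn; case: sp => _ _ /= PQ; have : set0 (e n) by rewrite -PQ.
    - exists (P, Q') => _; split=> //=; last by right.
      by split=> //=; rewrite setIC.
  by have [P' [sP' PP' P'n]] := grow _ _ _ sp nQn; exists (P', Q) => _;
    split=> //=; left.
have [s sP] := choice (fun np : nat * (set X * set X) => step np.1 np.2).
have [G1 [oG1 G1x G1U]] := regular_open_nbhs nU.
have [G2 [oG2 G2x G2G1]] := regular_open_nbhs (open_nbhs_nbhs (conj oG1 G1x)).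
pose PQ := fix PQ n := if n is m.+1 then s (m, PQ m) else (G2, ~` closure G1).
have PQ_sep n : sep (PQ n).
  elim: n => [|n IH]; last by have [] := sP (n, PQ n) IH.
  split=> //=; first by apply: closed_openC; exact: closed_closure.
  rewrite -subset0 => z [/G2G1 G1z] /(_ G1)[|y [nG1y G1y]].
    exact: open_nbhs_nbhs.
  by apply: nG1y; exact: subset_closure.
have PQ_le n m : (n <= m)%N -> (PQ n).1 `<=` (PQ m).1 /\ (PQ n).2 `<=` (PQ m).2.
  elim: m => [|m IH]; first by rewrite leqn0 => /eqP->; split.
  rewrite leq_eqVlt => /predU1P[->|/IH[h1 h2]]; first by split.
  have [_ g1 g2 _] := sP (m, PQ m) (PQ_sep m).
  by split=> z; [move=> /h1/g1|move=> /h2/g2].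
have disj n m z : (PQ n).1 z -> (PQ m).2 z -> False.
  move=> Pz Qz; have [_ _ PQ0] := PQ_sep (maxn n m).
  have [h1 _] := PQ_le _ _ (leq_maxl n m).
  have [_ h2] := PQ_le _ _ (leq_maxr n m).
  have : set0 z; last by [].
  by rewrite -PQ0; split; apply: subset_closure; [exact: h1|exact: h2].
exists (\bigcup_n (PQ n).1); split.
- split; first by apply: bigcup_open => n _; case: (PQ_sep n).
  rewrite -openC (_ : ~` _ = \bigcup_n (PQ n).2).
    by apply: bigcup_open => n _; case: (PQ_sep n).
  apply/seteqP; split=> z.
    have [n <-] := e_surj z => nP.
    have [_ _ _ [h|h]] := sP (n, PQ n) (PQ_sep n); last by exists n.+1.
    by case: nP; exists n.+1.
  by move=> [n _ Qz] [m _ Pz]; exact: disj Pz Qz.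
- by exists 0%N.
- move=> z [n _ Pz]; apply: G1U; apply: contrapT => nz.
  by apply: (disj n 0%N z).
Qed.

Lemma clopen_in_open (U : set X) : open U -> U !=set0 ->
  exists V, [/\ clopen V, V !=set0 & V `<=` U].
Proof.
move=> oU [x Ux]; have [|V [cV Vx VU]] := @countable_regular_clopen x U.
  exact: open_nbhs_nbhs.
by exists V; split=> //; exists x.
Qed.

Lemma open_forall_lt (V : nat -> set X) n : (forall j, open (V j)) ->
  open [set x | forall j, (j < n)%N -> V j x].
Proof.
move=> oV; elim: n => [|n IH].
  by rewrite (_ : mkset _ = setT); [exact: openT|exact/seteqP].
rewrite (_ : mkset _ = [set x | forall j, (j < n)%N -> V j x] `&` V n).
  exact: openI.
apply/seteqP; split=> [x h|x [h Vn] j].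
  by split=> [j jn|]; apply: h; rewrite ltnS// ltnW.
by rewrite ltnS leq_eqVlt => /predU1P[->//|/h].
Qed.

(** The space is cut into open columns, the [n]-th meeting [D] at most in [e n]. From column [n] a
    clopen neighbourhood of [e n] is removed, when [e n] is in [V] and [D], that contains no
    nonempty trace of a [b l] on the column. What remains inside [V] misses [D] and still meets
    every [b l]. *)
Lemma hitting_clopen (D V : set X) (L : Type) (B : set L) (b : L -> set X) :
  closed_discrete D -> clopen V ->
  (forall l, B l -> [/\ open (b l), b l !=set0 & b l `<=` V]) ->
  (forall x, V x -> D x -> avoidable B x) ->
  exists F, [/\ clopen F, F `<=` V, F `&` D = set0
    & forall l, B l -> F `&` b l !=set0].
Proof.
move=> [cD dD] cV hb avD.
have /choice[N hN] : forall n, exists N, [/\ clopen N, N (e n) & N `&` D `<=` [set e n]].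
  move=> n; have [Dn|nDn] := pselect (D (e n)).
    have [_ [M nM MD]] := dD _ Dn.
    have [N [cN Nn NM]] := countable_regular_clopen nM.
    by exists N; split=> // y [/NM My Dy]; rewrite -MD.
  have [|N [cN Nn ND]] := @countable_regular_clopen (e n) (~` D).
    by apply: open_nbhs_nbhs; split=> //; exact: closed_openC.
  by exists N; split=> // y [/ND].
have Nex x : exists n, `[< N n x >].
  by have [n <-] := e_surj x; exists n; apply/asboolP; case: (hN n).
pose iota x := ex_minn (Nex x).
have iotaN x : N (iota x) x by rewrite /iota; case: ex_minnP => n /asboolP.
have oiota n : open (iota @^-1` [set n]).
  rewrite (_ : _ @^-1` _ = [set x | forall j, (j < n)%N -> (~` N j) x] `&` N n).
    apply: openI; last by case: (hN n) => -[].
    by apply: open_forall_lt => j; rewrite openC; case: (hN j) => -[].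
  apply/seteqP; split=> [x /= <-|x [/= lt_n Nx]].
    split=> // j; rewrite /iota; case: ex_minnP => n' _ min jn Nj.
    by have := min j; rewrite leqNgt jn => /(_ (asboolT Nj)).
  rewrite /iota; case: ex_minnP => m /asboolP Nm min.
  apply/eqP; rewrite eqn_leq min ?andTb; last exact/asboolP.
  by rewrite leqNgt; apply/negP => /lt_n.
have /choice[W hW] : forall n, exists W, [/\ clopen W,
    V (e n) -> D (e n) -> W (e n)
  & forall l, B l -> (b l `&` iota @^-1` [set n]) !=set0 ->
      ~ (b l `&` iota @^-1` [set n] `<=` W)].
  move=> n; have [[Vn Dn]|nVD] := pselect (V (e n) /\ D (e n)); last first.
    exists set0; split; [exact: clopen0|by move=> ? ?; case: nVD|].
    by move=> l _ [y ly] /(_ _ ly).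
  (* Avoidance asks for open sets at all indices; the factor [[set y | B l]] makes the members
     outside [B] empty. *)
  have [|W nW WB] := avD _ Vn Dn (fun l => [set y | B l] `&` b l `&` iota @^-1` [set n]).
    move=> l; apply: openI => //; have [Bl|nBl] := pselect (B l).
      by rewrite (_ : mkset _ = setT) ?setTI; [case: (hb l)|apply/seteqP; split].
    by rewrite (_ : mkset _ = set0) ?set0I; [exact: open0|apply/seteqP; split=> // y /nBl].
  have [W' [cW' W'n W'W]] := countable_regular_clopen nW.
  exists W'; split=> // l Bl [y [bly yn]] sub; apply: (WB l) => //.
    by exists y.
  by move=> z [[_ blz] zn]; apply: W'W; exact: sub.
exists (V `&` [set x | ~ W (iota x) x]); split.
- apply: clopenI => //; apply: (clopen_glue (P := fun n => ~` W n)) => // n.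
  by apply: clopenC; case: (hW n).
- by move=> x [].
- rewrite -subset0 => x [[Vx nW] Dx]; apply: nW.
  have [_ _ /(_ x (conj (iotaN x) Dx)) /= xE] := hN (iota x).
  have [_ h _] := hW (iota x).
  by rewrite -xE in h; exact: h.
- move=> l Bl; have [_ [y bly] blV] := hb l Bl.
  have [_ _ /(_ l Bl)] := hW (iota y).
  move=> /(_ (ex_intro _ y (conj bly erefl)))/existsNP[z /not_implyP[[blz zy] nz]].
  by exists z; split=> //; split; [exact: blV|rewrite /= zy].
Qed.

(** * Crowded spaces and van Douwen's construction over a pi-base *)

Hypothesis X_crowded : isolated [set: X] = set0.

Lemma crowded_other (x : X) (U : set X) : nbhs x U -> exists2 y, U y & y <> x.
Proof.
move=> nU; apply: contrapT => nex.
suff : isolated [set: X] x by rewrite X_crowded.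
split; first by rewrite inE.
exists U => //; rewrite setIT; apply/seteqP; split=> [y Uy|_ ->].
  by apply: contrapT => yx; apply: nex; exists y.
exact: nbhs_singleton.
Qed.

(** Each nonempty member contains a point other than [x]; the neighbourhood omits these finitely
    many points. *)
Lemma avoidable_finite (L : Type) (B : set L) (x : X) :
  finite_set B -> avoidable B x.
Proof.
move=> Bfin c oc.
have /choice[z hz] : forall l, exists z, c l !=set0 -> c l z /\ z <> x.
  move=> l; have [[y cy]|nc] := pselect (c l !=set0); last by exists x.
  case: (pselect (y = x)) cy => [-> cy|yx cy]; last by exists y.
  by have [|z cz zx] := @crowded_other x (c l); [exact: open_nbhs_nbhs|exists z].
pose Z := z @` (B `&` [set l | c l !=set0]).
have cZ : closed Z.
  apply: (proj1 accessible_finite_set_closed X_accessible).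
  by apply: finite_image; exact: finite_setIl.
exists (~` Z).
  apply: open_nbhs_nbhs; split; first exact: closed_openC.
  by move=> [l [_ /hz[_ +]]].
move=> l Bl cl /(_ (z l)) h; have [cz _] := hz l cl.
by apply: (h cz); exists l.
Qed.

Lemma open_not_closed_discrete (D U : set X) :
  closed_discrete D -> open U -> U !=set0 -> (U `\` D) !=set0.
Proof.
move=> [_ dD] oU [x Ux]; apply: contrapT => nUD.
have UD : U `<=` D by move=> y Uy; apply: contrapT => nDy; apply: nUD; exists y.
have [_ [M nM MD]] := dD _ (UD _ Ux).
have [|y [My Uy] yx] := @crowded_other x (M `&` U).
  by apply: filterI => //; exact: open_nbhs_nbhs.
apply: yx; have : (M `&` D) y by split=> //; exact: UD.
by rewrite MD.
Qed.

(** The columns are the differences of a decreasing sequence of clopen sets [E n], where [E n.+1]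
    omits [e n], so that the intersection is empty. *)
Lemma clopen_columns (U : set X) : open U -> U !=set0 ->
  exists iota : X -> nat, forall n,
    open (iota @^-1` [set n]) /\ (iota @^-1` [set n] `&` U) !=set0.
Proof.
move=> oU U0; have oC (x : X) : open (~` [set x]).
  by rewrite openC; exact: accessible_closed_set1.
have /choice[s hs] : forall kE : nat * set X, exists E',
    clopen kE.2 -> (kE.2 `&` U) !=set0 ->
    [/\ clopen E', (E' `&` U) !=set0, E' `<=` kE.2, ~ E' (e kE.1)
      & ((kE.2 `\` E') `&` U) !=set0].
  move=> [k E] /=; have [[cE [x EUx]]|nE] := pselect (clopen E /\ (E `&` U) !=set0);
    last by exists set0 => ? ?; case: nE.
  have oEU : open (E `&` U) by apply: openI => //; case: cE.
  have [z EUz zk] : exists2 z, (E `&` U) z & z <> e k.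
    have [xk|xk] := pselect (x = e k); last by exists x.
    by rewrite -xk; apply: crowded_other; exact: open_nbhs_nbhs.
  have [|z' EUz' z'z] := @crowded_other z (E `&` U); first exact: open_nbhs_nbhs.
  (* [z] keeps the next set meeting [U], and [z'], left outside it, keeps the difference meeting
     [U]. *)
  have [|E' [cE' E'z E'EU]] := @countable_regular_clopen z
      ((E `&` U) `&` ~` [set e k] `&` ~` [set z']).
    apply: open_nbhs_nbhs; split; first by do 2?apply: openI.
    by do 2?split => //; exact: nesym.
  exists E' => _ _; split=> //.
  - by exists z; split=> //; case: EUz.
  - by move=> y /E'EU[[[]]].
  - by move=> /E'EU[[_ nk _]]; exact: nk.
  - exists z'; split; last by case: EUz'.
    by split; [case: EUz'|move=> /E'EU[_ nz']; exact: nz'].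
pose E := fix E n := if n is m.+1 then s (m, E m) else setT.
have hE n : clopen (E n) /\ (E n `&` U) !=set0.
  elim: n => [|n [cE EU]]; first by rewrite /= setTI; split=> //; exact: clopenT.
  by have [] := hs (n, E n) cE EU.
have hS n : [/\ E n.+1 `<=` E n, ~ E n.+1 (e n) & ((E n `\` E n.+1) `&` U) !=set0].
  by have [? ?] := hE n; have [] := hs (n, E n).
have E_le n m : (n <= m)%N -> E m `<=` E n.
  elim: m => [|m IH]; first by rewrite leqn0 => /eqP->.
  rewrite leq_eqVlt => /predU1P[->//|/IH h x]; have [h' _ _] := hS m.
  by move=> /h'/h.
have Eex x : exists n, `[< ~ E n.+1 x >].
  by have [n <-] := e_surj x; exists n; apply/asboolP; case: (hS n).
pose iota x := ex_minn (Eex x).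
have iotaE n : iota @^-1` [set n] = E n `\` E n.+1.
  apply/seteqP; split=> [x /= <-|x [En nEn]].
    rewrite /iota; case: ex_minnP => -[|m] /asboolP nE min; first by [].
    split=> //; apply: contrapT => nEm.
    by have := min m (asboolT nEm); rewrite ltnn.
  rewrite /= /iota; case: ex_minnP => m /asboolP nE min.
  apply/eqP; rewrite eqn_leq min; last exact/asboolP.
  rewrite leqNgt; apply/negP => mn; apply: nE; exact: E_le mn _ En.
exists iota => n; rewrite iotaE; split; last by case: (hS n).
by rewrite setDE; apply: openI; [case: (hE n) => -[]|rewrite openC; case: (hE n.+1) => -[]].
Qed.

(* Van Douwen's argument, with the regular well-order [lt] in the role of
   [nat]: the [m]-th approximation of the set assigned to [D] meets, in a set of
   the pi-base with controlled index, all members of the pi-base with index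
   below the one reached by the previous approximation. Any [k.+1] of the sets
   are then intersected one after the other, the one with the largest [k]-th
   index last. *)
Lemma pi_base_linked (I : Type) (lt : I -> I -> Prop) (b : I -> set X)
    (V : set X) : well_order lt -> clopen V -> V !=set0 ->
  (forall i, [/\ open (b i), b i !=set0 & b i `<=` V]) ->
  (forall U, open U -> U !=set0 -> U `<=` V -> exists i, b i `<=` U) ->
  (forall i x, V x -> avoidable [set j | lt j i] x) ->
  (forall i (f : I -> I), exists k, forall j, lt j i -> ~ lt k (f j)) ->
  forall n, exists Phi : set X -> set X,
    (forall D, closed_discrete D ->
      [/\ clopen (Phi D), Phi D `<=` V & Phi D `&` D = set0]) /\
    linked (@closed_discrete X) (fun D => V `&` Phi D) n.
Proof.
move=> wo cV V0 hb pi_b avV bound n.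
have irr i := @wo_irrefl _ _ i wo.
have base D : closed_discrete D -> exists Fi : set X * I,
    [/\ clopen Fi.1, Fi.1 `<=` V, Fi.1 `&` D = set0 & b Fi.2 `<=` Fi.1].
  move=> cD; have [||F [cF F0 FVD]] := @clopen_in_open (V `\` D).
  - by rewrite setDE; apply: openI; [case: cV|rewrite openC; case: cD].
  - by apply: open_not_closed_discrete => //; case: cV.
  have FV : F `<=` V by move=> x /FVD[].
  have [|i bF] := pi_b F _ F0 FV; first by case: cF.
  by exists (F, i); split=> //=; rewrite -subset0 => x [/FVD[_ nD] /nD].
have step (Di : set X * I) : exists Fk : set X * I, closed_discrete Di.1 ->
    [/\ clopen Fk.1, Fk.1 `<=` V, Fk.1 `&` Di.1 = set0
      & forall j, ~ lt Di.2 j -> exists j', ~ lt Fk.2 j' /\ b j' `<=` Fk.1 `&` b j].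
  case: Di => D i /=; have [cD|ncD] := pselect (closed_discrete D); last first.
    by exists (D, i).
  have [|F [cF FV FD Fb]] := @hitting_clopen D V I [set j | ~ lt i j] b cD cV (fun i _ => hb i).
    (* The indices up to and including [i] are its predecessors and one more, which is a finite
       family. *)
    move=> x Vx _; suff : avoidable ([set j | lt j i] `|` [set i]) x.
      apply: avoidable_card_le; first by exists i; right.
      apply: subset_card_le => j /= ij.
      by have [|->|] := wo_total wo i j => //; [right|left].
    by apply: avoidableU; [exact: avV|exact: avoidable_finite].
  have /choice[f fP] : forall j, exists j', ~ lt i j -> b j' `<=` F `&` b j.
    move=> j; have [ij|nij] := pselect (lt i j); first by exists j.
    have [bo b0 bV] := hb j.
    have [||j' bj'] := pi_b (F `&` b j) _ (Fb j nij); last by exists j'.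
      by apply: openI => //; case: cF.
    by move=> x [_ /bV].
  (* Regularity bounds [f] below [i] only; the maximum with [f i] covers the index [i] itself. *)
  have [k0 k0P] := bound i f; have [k [kk0 kfi]] := wo_le_max k0 (f i) wo.
  exists (F, k) => _; split=> //= j nij; exists (f j); split; last exact: fP.
  have [//|<-//|ji] := wo_total wo i j.
  exact: wo_le_trans wo (k0P _ ji) kk0.
have [s sP] := choice step.
have /choice[Fi0 Fi0P] : forall D, exists Fi : set X * I, closed_discrete D ->
    [/\ clopen Fi.1, Fi.1 `<=` V, Fi.1 `&` D = set0 & b Fi.2 `<=` Fi.1].
  move=> D; have [/base[Fi]|ncD] := pselect (closed_discrete D); first by exists Fi.
  have [x Vx] := V0; have [||i _] := pi_b V _ V0 => //; first by case: cV.
  by exists (D, i).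
pose G D := fix G m := if m is m'.+1 then s (D, (G m').2) else Fi0 D.
have GP D m : closed_discrete D ->
    [/\ clopen (G D m).1, (G D m).1 `<=` V & (G D m).1 `&` D = set0].
  move=> cD; case: m => [|m]; first by have [] := Fi0P D cD.
  by have [] := sP (D, (G D m).2) cD.
(* The bound on [j] carries the induction: once the member [D] with the largest [k]-th index is
   removed, the [j] found for the others is at most that index, so the next approximation for [D]
   meets [b j] in some [b j'] of bounded index. *)
have key k l : size l = k.+1 -> (forall D, D \in l -> closed_discrete D) ->
    exists2 D, D \in l & exists2 j, ~ lt (G D k).2 j &
      b j `<=` [set x | forall D', D' \in l -> exists2 m, (m <= k)%N & (G D' m).1 x].
  elim: k l => [|k IH] l sl lD.
    case: l sl lD => [//|D [|//]] _ /(_ D (mem_head _ _)) cD.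
    have [_ _ _ bF] := Fi0P D cD; exists D; first exact: mem_head.
    exists (G D 0).2 => //= x /bF Fx D'; rewrite inE => /eqP->.
    by exists 0%N.
  have [|l1 [D [l2 [lE Dmax]]]] := wo_seq_max (fun D => (G D k).2) wo (l := l).
    by move=> l0; rewrite l0 in sl.
  have l12 D' : D' \in l1 ++ l2 -> D' \in l.
    by rewrite lE !mem_cat inE => /orP[->|->]//; rewrite !orbT.
  have Dl : D \in l by rewrite lE mem_cat mem_head orbT.
  have [||D' D'l [j jD' bj]] := IH (l1 ++ l2).
  - by move: sl; rewrite lE !size_cat /= addnS => -[].
  - by move=> D' /l12/lD.
  have [_ _ _ /(_ j)[|j' [j'D bj']]] := sP (D, (G D k).2) (lD _ Dl).
    by apply: wo_le_trans wo jD' _; apply: Dmax; exact: l12.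
  exists D => //; exists j' => // x /bj'[Fx /bj bx] E.
  rewrite lE mem_cat inE orbCA => /predU1P[->|]; first by exists k.+1.
  by rewrite -mem_cat => /bx[m mk Fm]; exists m => //; exact: leqW.
exists (fun D => [set x | exists2 m, (m < n)%N & (G D m).1 x]); split.
  move=> D cD; split; last first.
  - rewrite -subset0 => x [[m _ Fx] Dx].
    by have [_ _ <-] := GP D m cD; split.
  - by move=> x [m _]; have [_ + _] := GP D m cD; apply.
  elim: n => [|n IH].
    rewrite (_ : mkset _ = set0); first exact: clopen0.
    by apply/seteqP; split=> // x [].
  rewrite (_ : mkset _ = [set x | exists2 m, (m < n)%N & (G D m).1 x] `|` (G D n).1).
    by apply: clopenU => //; have [] := GP D n cD.
  apply/seteqP; split=> [x [m]|x [[m mn Fx]|Fx]].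
  - by rewrite ltnS leq_eqVlt => /predU1P[->|mn] Fx; [right|left; exists m].
  - by exists m => //; exact: leqW.
  - by exists n.
move=> l; case: (posnP (size l)) => [/size0nil-> _ _|l0 ln lD].
  by have [x Vx] := V0; exists x.
have [D Dl [j _ bj]] := key (size l).-1 l (esym (prednK l0)) lD.
have [_ [x bx] bV] := hb j; exists x => E El; split; first exact: bV.
have [m mk Fx] := bj _ bx _ El; exists m => //.
by apply: leq_trans ln; rewrite -(prednK l0).
Qed.

(** Being linked for every [n] is the finite intersection property. *)
Definition far_assignment (Phi : set X -> set X) :=
  (forall D, closed_discrete D -> clopen (Phi D) /\ Phi D `&` D = set0) /\
  forall n, linked (@closed_discrete X) Phi n.

(** A single construction is only [n]-linked. One is carried out for each [n] inside column [n], and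
    the results are glued; a list of length [n] then has a common point in column [n]. *)
Lemma pi_base_far_assignment (I : Type) (lt : I -> I -> Prop) (b : I -> set X)
    (U : set X) : well_order lt -> open U -> U !=set0 ->
  (forall i, open (b i)) ->
  (forall O, open O -> O !=set0 -> O `<=` U ->
    exists2 i, b i !=set0 & b i `<=` O) ->
  (forall i x, U x -> avoidable [set j | lt j i] x) ->
  (forall i (f : I -> I), exists k, forall j, lt j i -> ~ lt k (f j)) ->
  exists Phi, far_assignment Phi.
Proof.
move=> wo oU U0 ob pi_b avU bound.
have [iota iotaP] := clopen_columns oU U0.
have /choice[V hV] : forall n, exists V, [/\ clopen V, V !=set0
    & V `<=` iota @^-1` [set n] `&` U].
  by move=> n; have [oi iU] := iotaP n; apply: clopen_in_open => //; exact: openI.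
have /choice[Phi hPhi] : forall n, exists Phi : set X -> set X,
    (forall D, closed_discrete D ->
      [/\ clopen (Phi D), Phi D `<=` V n & Phi D `&` D = set0]) /\
    linked (@closed_discrete X) (fun D => V n `&` Phi D) n.
  move=> n; have [cV V0 VU] := hV n.
  have oV : open (V n) by case: cV.
  (* Members of the restricted pi-base must be nonempty, so an empty trace is replaced by [V n]. *)
  pose c i := if pselect ((b i `&` V n) !=set0) then b i `&` V n else V n.
  apply: (@pi_base_linked I lt c) => //.
  - move=> i; rewrite /c; case: pselect => bV /=; last by split.
    by split=> //; exact: openI.
  - move=> O oO O0 OV; have [|i [x bx] bO] := pi_b O oO O0.
      by move=> x /OV/VU[].
    exists i; rewrite /c; case: pselect => bV; first by move=> y [/bO].
    by case: bV; exists x; split=> //; exact/OV/bO.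
  - by move=> i x /VU[_]; exact: avU.
exists (fun D => [set x | Phi (iota x) D x]); split=> [D cD|n l _ lD].
  split.
    apply: (clopen_glue (P := fun n => Phi n D)); first by move=> n; case: (iotaP n).
    by move=> n; have [/(_ D cD)[]] := hPhi n.
  rewrite -subset0 => x [Px Dx].
  by have [/(_ D cD)[_ _ <-] _] := hPhi (iota x); split.
have [_ /(_ l (leqnn _) lD)[x xP]] := hPhi (size l).
case: l lD xP => [_ _|D l lD xP]; first by exists x.
have [Vx _] := xP D (mem_head _ _); have [_ _ VU] := hV (size (D :: l)).
by exists x => E El /=; have [/= -> _] := VU _ Vx; case: (xP E El).
Qed.

Lemma clopen_forall_seq (T : eqType) (F : T -> set X) (l : seq T) :
  (forall t, t \in l -> clopen (F t)) ->
  clopen [set x | forall t, t \in l -> F t x].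
Proof.
elim: l => [|t l IH] cF.
  by rewrite (_ : mkset _ = setT); [exact: clopenT|exact/seteqP].
rewrite (_ : mkset _ = F t `&` [set x | forall t, t \in l -> F t x]).
  apply: clopenI; first by apply: cF; exact: mem_head.
  by apply: IH => u ul; apply: cF; rewrite inE ul orbT.
apply/seteqP; split=> [x h|x [Ftx h] u].
  by split=> [|u ul]; apply: h; rewrite inE ?eqxx// ul orbT.
by rewrite inE => /predU1P[->//|]; exact: h.
Qed.

(** * Transfinite construction along columns of increasing pi-character *)

Section Columns.
Variables (iota : X -> nat) (V : nat -> set X).
Hypothesis open_iota : forall n, open (iota @^-1` [set n]).
Hypothesis clopen_V : forall n, clopen (V n).
Hypothesis V_neq0 : forall n, V n !=set0.
Hypothesis V_iota : forall n, V n `<=` iota @^-1` [set n].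
Variable A : nat -> Type.
Hypothesis A_infinite : forall n, infinite_set [set: A n].
Hypothesis A_le : forall m n, (m <= n)%N -> [set: A m] #<= [set: A n].
Hypothesis V_avoidable : forall n x, V n x -> avoidable [set: A n] x.

(** Meeting in almost all columns is the invariant of the recursion: each later step may then give
    up finitely many columns for a given list. *)
Definition eventually_meet (T : eqType) (F : T -> set X) (l : seq T) :=
  exists N, forall n, (N <= n)%N -> exists2 x, V n x & forall t, t \in l -> F t x.

(** The tag and an image in [A n] determine the element, and the infinite [A n] absorbs the
    countable factor. *)
Lemma bounded_tag_card_le n : [set p : {k & A k} | (tag p <= n)%N] #<= [set: A n].
Proof.
have [a _] := infinite_setN0 (@A_infinite n).
have inj k : exists f : A k -> A n, (k <= n)%N -> injective f.
  have [/A_le/card_leT_inj[f finj]|nk] := boolP (k <= n)%N; first by exists f.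
  by exists (fun=> a).
have card_nat : [set: nat] #<= [set: A n] by exact/infiniteP.
apply: card_le_trans (card_prod_le (@A_infinite n) card_nat (card_lexx [set: A n])).
pose f k := projT1 (cid (inj k)).
have finj k : (k <= n)%N -> injective (f k) by exact: (projT2 (cid (inj k))).
apply: (@card_le_of_inj _ _ _ _ (fun p : {k & A k} => (tag p, f _ (tagged p)))) => //.
move=> [k x] [l y]; rewrite !inE /= => kn _ [kl]; subst l.
by move=> /(finj _ kn)->.
Qed.

Lemma seq_bounded_tag_card_le n (T : eqType) (S : set T) (h : T -> {k & A k}) :
  {in S &, injective h} ->
  [set l : seq T | forall t, t \in l -> S t /\ (tag (h t) <= n)%N] #<= [set: A n].
Proof.
move=> hinj; have [a _] := infinite_setN0 (@A_infinite n).
have [c _ cinj] := card_le_fun a (bounded_tag_card_le n).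
apply: card_le_trans (card_seq (@A_infinite n)).
apply: (@card_le_of_inj _ _ _ _ (map (c \o h))) => // l l'; rewrite !inE /=.
elim: l l' => [|t l IH] [|t' l'] //= lS l'S [tt' ll'].
have [St ht] := lS _ (mem_head _ _); have [St' ht'] := l'S _ (mem_head _ _).
congr cons; first by apply: hinj; rewrite ?inE//; apply: cinj; rewrite ?inE.
by apply: IH => // u ul; [apply: lS|apply: l'S]; rewrite inE ul orbT.
Qed.

(** The tags under [h] rank the earlier sets. In column [n] only lists of rank at most [n] are
    treated; there are at most aleph_n of them, so [hitting_clopen] applies in [V n]. A given list
    has bounded rank and is thus treated in almost all columns. *)
Lemma eventually_meet_extend (S : set (set X)) (F : set X -> set X) (D : set X) :
  S #<= [set: {n & A n}] -> (forall E, clopen (F E)) ->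
  (forall l : seq (set X), (forall E, E \in l -> S E) -> eventually_meet F l) ->
  exists F', [/\ clopen F', closed_discrete D -> F' `&` D = set0
    & forall l : seq (set X), (forall E, E \in l -> S E) ->
        exists N, forall n, (N <= n)%N ->
          exists2 x, V n x & F' x /\ forall E, E \in l -> F E x].
Proof.
move=> SA cF FS; have [cD|ncD] := pselect (closed_discrete D); last first.
  exists setT; split=> // [|l /FS[N hN]]; first exact: clopenT.
  by exists N => n /hN[x Vx Fx]; exists x.
have [a _] := infinite_setN0 (@A_infinite 0).
have [h _ hinj] := card_le_fun (existT A 0%N a) SA.
pose b n (l : seq (set X)) := V n `&` [set x | forall E, E \in l -> F E x].
pose B n := [set l : seq (set X) | (forall E, E \in l -> S E /\ (tag (h E) <= n)%N)]
  `&` [set l | b n l !=set0].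
have /choice[G hG] : forall n, exists G, [/\ clopen G, G `<=` V n, G `&` D = set0
    & forall l, B n l -> G `&` b n l !=set0].
  move=> n; apply: hitting_clopen => // [l [_ bl]|x Vx _].
    split=> //; last by move=> x [].
    by apply: openI; [case: (clopen_V n)|have [] := clopen_forall_seq (l := l) (fun E _ => cF E)].
  apply: (avoidable_card_le _ _ (V_avoidable Vx)); first exact: infinite_setN0.
  by apply: card_le_trans (seq_bounded_tag_card_le n hinj);
    apply: subset_card_le; exact: subIsetl.
exists [set x | G (iota x) x]; split.
- by apply: (clopen_glue (P := G)) => // n; case: (hG n).
- by move=> _; rewrite -subset0 => x [Gx Dx]; have [_ _ <- _] := hG (iota x); split.
- move=> l lS; have [N hN] := FS l lS.
  have [r hr] : exists r, forall E, E \in l -> (tag (h E) <= r)%N.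
    elim: l {lS hN} => [|E l [r hr]]; first by exists 0%N.
    exists (maxn (tag (h E)) r) => E'; rewrite inE => /predU1P[->|/hr le_r].
      exact: leq_maxl.
    exact: leq_trans le_r (leq_maxr _ _).
  exists (maxn N r) => n; rewrite geq_max => /andP[Nn rn].
  have [_ GV _ /(_ l)] := hG n; case.
    split; last by have [x Vx Fx] := hN n Nn; exists x.
    by move=> E El; split; [exact: lS|exact: leq_trans (hr _ El) rn].
  move=> x [Gx [Vx Fx]]; exists x => //; split=> //=.
  by have /= -> := V_iota Vx.
Qed.

Lemma transfinite_far_assignment (lt : set X -> set X -> Prop) :
  well_order lt -> (forall D, [set E | lt E D] #<= [set: {n & A n}]) ->
  exists Phi, far_assignment Phi.
Proof.
move=> wo seg.
have step (DF : set X * (set X -> set X)) : exists F',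
    (forall E, clopen (DF.2 E)) ->
    (forall l : seq (set X), (forall E, E \in l -> lt E DF.1) -> eventually_meet DF.2 l) ->
    [/\ clopen F', closed_discrete DF.1 -> F' `&` DF.1 = set0
    & forall l : seq (set X), (forall E, E \in l -> lt E DF.1) ->
        exists N, forall n, (N <= n)%N ->
          exists2 x, V n x & F' x /\ forall E, E \in l -> DF.2 E x].
  case: DF => D F /=; have [[cF FS]|nF] := pselect ((forall E, clopen (F E)) /\
    forall l : seq (set X), (forall E, E \in l -> lt E D) -> eventually_meet F l); last first.
    by exists setT => cF FS; case: nF.
  by have [F'] := eventually_meet_extend D (seg D) cF FS; exists F'.
have [s sP] := choice step.
(* The step expects a set for every [E]; those that do not precede [D] get the whole space, which is
   clopen. *)
pose body D (rec : forall E, lt E D -> set X) := s (D, fun E =>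
  if pselect (lt E D) is left ED then rec E ED else setT).
pose Phi := Fix (wo_wf wo) (fun=> set X) body.
pose restr D E := if pselect (lt E D) then Phi E else setT.
have PhiE D : Phi D = s (D, restr D).
  rewrite /Phi Fix_eq; last first.
    move=> E f g fg; congr (s (_, _)); apply/funext => G.
    by case: pselect.
  by congr (s (_, _)); apply/funext => E; rewrite /restr; case: pselect.
pose Q D := [/\ clopen (Phi D), closed_discrete D -> Phi D `&` D = set0
  & forall l : seq (set X), (forall E, E \in l -> lt E D) -> eventually_meet Phi (D :: l)].
have Q_meet l : (forall E, E \in l -> Q E) -> eventually_meet Phi l.
  move=> lQ; have [->|/eqP l0] := eqVneq l [::].
    by exists 0%N => n _; have [x Vx] := V_neq0 n; exists x.
  have [l1 [E [l2 [lE Emax]]]] := wo_seq_max id wo l0.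
  have El : E \in l by rewrite lE mem_cat mem_head orbT.
  (* All copies of the largest member [E] are removed, since [l] may repeat it; the others precede
     [E], and the invariant at [E] applies. *)
  have [_ _ /(_ [seq G <- l | G != E])[G|N hN]] := lQ E El.
    rewrite mem_filter => /andP[/eqP GE Gl].
    by have [//|/GE//|/(Emax _ Gl)//] := wo_total wo G E.
  exists N => n /hN[x Vx Px]; exists x => // G Gl; apply: Px.
  by rewrite inE mem_filter Gl andbT; case: eqVneq.
have QD D : Q D.
  elim/(well_founded_ind (wo_wf wo)): D => D IH.
  have [||cP DP lP] := sP (D, restr D).
  - by move=> E /=; rewrite /restr; case: pselect => h /=; [by case: (IH _ h)|exact: clopenT].
  - move=> l /= lD; have [|N hN] := Q_meet l; first by move=> E /lD/IH.
    exists N => n /hN[x Vx Px]; exists x => // E El; rewrite /restr.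
    by case: pselect => h //=; exact: Px.
  rewrite -PhiE in cP DP lP; split=> // l lD.
  have [N hN] := lP l lD; exists N => n /hN[x Vx [Px lx]]; exists x => // E.
  rewrite inE => /predU1P[->//|El]; have := lx E El.
  by rewrite /= /restr; case: pselect => // nED; case: nED; exact: lD.
exists Phi; split=> [D cD|n l _ lD]; first by have [? PD _] := QD D; split=> //; exact: PD.
have [|N hN] := Q_meet l; first by [].
by have [x _ Px] := hN N (leqnn N); exists x.
Qed.

End Columns.

End CountableRegular.

(** * Far points from clopen sets *)

Lemma clopen_indicator_continuous (R : realType) (X : topologicalType) (G : set X) :
  clopen G -> continuous (\1_G : X -> R)%R.
Proof.
move=> [oG cG] x; apply: cvg_near_cst.
have [Gx|nGx] := pselect (G x).
  have : nbhs x G by exact: open_nbhs_nbhs.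
  by apply: filterS => y Gy; rewrite !indicE !mem_set.
have : nbhs x (~` G) by apply: open_nbhs_nbhs; split=> //; exact: closed_openC.
by apply: filterS => y nGy; rewrite !indicE !memNset.
Qed.

(** The sets [Phi D] generate a filter, whose image clusters at some [p] in the compact cube. The
    indicator of the clopen [Phi D] is a coordinate that is at least 1 at [p] and 0 on [D], which
    keeps [p] out of the closure of [D]. *)
Lemma far_assignment_far_point (R : realType) (X : topologicalType)
    (Phi : set X -> set X) : accessible_space X -> far_assignment Phi ->
  exists p : stone_cech R X, far_point p.
Proof.
move=> X_acc [PhiD Phi_linked].
pose FF : set_system X := [set B | exists2 l : seq (set X),
  forall D, D \in l -> closed_discrete D
  & [set x | forall D, D \in l -> Phi D x] `<=` B].
have FF_filter : ProperFilter FF.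
  apply: Build_ProperFilter_ex.
    move=> B [l lD lB]; have [x Px] := Phi_linked _ l (leqnn _) lD.
    by exists x; exact: lB.
  split.
  - by exists [::].
  - move=> B C [l lD lB] [m mD mC]; exists (l ++ m).
      by move=> D; rewrite mem_cat => /orP[/lD|/mD].
    move=> x Px; split; [apply: lB => D Dl|apply: mC => D Dm]; apply: Px.
      by rewrite mem_cat Dl.
    by rewrite mem_cat Dm orbT.
  - by move=> B C BC [l lD lB]; exists l => //; exact: subset_trans BC.
pose I := @unit_interval_maps R X; pose ev := @evaluation R X.
pose cube : set (prod_topology (fun _ : I => R)) :=
  [set g | forall i, `[0%R, 1%R]%classic (g i)].
have cube_compact : compact cube.
  by apply: (@tychonoff I (fun=> R) (fun=> `[0%R, 1%R]%classic)) => i;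
    exact: segment_compact.
have [p [_ p_cluster]] : cube `&` cluster (ev @ FF) !=set0.
  apply: cube_compact; exists [::] => // x _ i /=.
  by have [_ /(_ x)] := set_valP i; rewrite in_itv.
have p_closure B : FF B -> closure (ev @` B) p.
  move=> FB N nN; apply: p_cluster nN; apply: filterS FB => x Bx.
  by exists x.
have p_range : closure (range ev) p by apply: p_closure; exists [::].
pose q : stone_cech R X := SigSub (mem_set p_range).
have far D : closed_discrete D -> ~ closure (@stone_cech_unit R X @` D) q.
  move=> cD Dq; have [cP PD0] := PhiD D cD.
  have chi_unit : unit_interval_maps (\1_(Phi D) : X -> R)%R.
    split; first exact: clopen_indicator_continuous.
    by move=> x; rewrite indicE; case: (x \in _); rewrite /= ?lexx ler01.
  pose chi : I := SigSub (mem_set chi_unit).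
  have ev_chi x : ev x chi = (\1_(Phi D) x)%R by [].
  have proj_chi : continuous (fun g : prod_topology (fun _ : I => R) => g chi).
    exact: proj_continuous.
  have p_chi : (1 <= p chi)%R.
    rewrite leNgt; apply/negP => p1.
    have FD : FF (Phi D).
      exists [:: D]; first by move=> E; rewrite inE => /eqP->.
      by move=> x; apply; rewrite inE.
    have [|_ [[x Px <-]]] := p_closure _ FD [set g | (g chi < 1)%R].
      exact: (proj_chi p [set r | (r < 1)%R] (lt_nbhsl p1)).
    by rewrite /= ev_chi indicE mem_set// ltxx.
  have [|_ [[x Dx <-] x0]] := Dq [set r | (0 < (set_val r : I -> R) chi)%R].
    have val_cont := @initial_continuous _ _
      (set_val : closure (range ev) -> prod_topology (fun _ : I => R)).
    have p0 : (0 < p chi)%R by apply: lt_le_trans p_chi; exact: ltr01.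
    exact: (val_cont q _ (proj_chi p [set r | (0 < r)%R] (lt_nbhsr p0))).
  have : (0 < ev x chi)%R := x0.
  rewrite ev_chi indicE memNset ?ltxx// => Px.
  by have : set0 x by rewrite -PD0; split.
exists q; split=> // -[x _ xq].
(* A singleton is closed discrete, so [q] is not the image of a point of [X]. *)
apply: (far [set x]); last by apply: subset_closure; exists x.
split; first exact: accessible_closed_set1.
move=> _ ->; split; first by rewrite inE.
by exists setT; [exact: filterT|rewrite setTI].
Qed.

(** * Local pi-bases and the case distinction *)

Lemma countable_enumeration (T : Type) : [set: T] !=set0 -> countable [set: T] ->
  exists e : nat -> T, forall x, exists n, e n = x.
Proof.
move=> [t _] /card_leT_inj[f finj].
have /choice[e eP] : forall n, exists x, (exists y, f y = n) -> f x = n.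
  move=> n; have [[x fx]|nx] := pselect (exists y, f y = n); first by exists x.
  by exists t => /nx.
by exists e => x; exists (f x); apply: finj; apply: eP; exists x.
Qed.

Definition pi_character_le (X : topologicalType) (L : Type) : set X :=
  [set x | ~ avoidable [set: L] x].

Lemma pi_character_le_local_base (X : topologicalType) (L : Type) (x : X) :
  pi_character_le L x -> exists c : L -> set X, (forall l, open (c l)) /\
    forall W, nbhs x W -> exists2 l, c l !=set0 & c l `<=` W.
Proof.
move=> /existsNP[c /not_implyP[oc nW]]; exists c; split=> // W nbW.
apply: contrapT => nl; apply: nW; exists W => // l _ cl cW.
by apply: nl; exists l.
Qed.

(** The local pi-bases at the countably many points are put together; [nat * L] embeds in [L], so
    [L] still indexes the result. *)
Lemma dense_pi_character_pi_base (X : topologicalType) (e : nat -> X)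
    (L : Type) (U : set X) :
  (forall x, exists n, e n = x) -> infinite_set [set: L] ->
  U `<=` closure (pi_character_le L) ->
  exists b : L -> set X, (forall i, open (b i)) /\
    forall O, open O -> O !=set0 -> O `<=` U ->
      exists2 i, b i !=set0 & b i `<=` O.
Proof.
move=> e_surj Linf UY.
have /choice[c cP] : forall x : X, exists c : L -> set X, (forall l, open (c l)) /\
    (pi_character_le L x -> forall W, nbhs x W ->
      exists2 l, c l !=set0 & c l `<=` W).
  move=> x; have [/pi_character_le_local_base[c [oc cP]]|nx] :=
    pselect (pi_character_le L x); first by exists c.
  by exists (fun=> set0); split=> [l|/nx//]; exact: open0.
have [j jinj] : exists j : nat * L -> L, injective j.
  apply: card_leT_inj; apply: card_prod_le => //; exact/infiniteP.
exists (fun i => \bigcup_(p in j @^-1` [set i]) c (e p.1) p.2); split.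
  by move=> i; apply: bigcup_open => p _; exact: (cP _).1.
move=> O oO [x Ox] OU; have [|y [Yy Oy]] := UY _ (OU _ Ox) O.
  exact: open_nbhs_nbhs.
have [|l [z clz] clO] := (cP y).2 Yy O; first exact: open_nbhs_nbhs.
have [k ky] := e_surj y; rewrite -ky in clz clO.
exists (j (k, l)); first by exists z, (k, l).
by move=> w [p /= /jinj-> /clO].
Qed.

Theorem corollary4p8 (R : realType) (hc : continuum_le_aleph_omega_succ)
    (X : topologicalType) (hX2 : hausdorff_space X) (hX3 : regular_space X)
    (hXcount : countable [set: X]) (hXcrowded : crowded X) :
  exists p : stone_cech R X, far_point p.
Proof.
have [X0 X_crowded] := hXcrowded; have [e e_surj] := countable_enumeration X0 hXcount.
have X_acc := hausdorff_accessible hX2.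
suff [Phi] : exists Phi : set X -> set X, far_assignment Phi.
  exact: far_assignment_far_point.
have [K [[A [W [A_aleph W_aleph K_aleph]]] cK]] := hc.
pose Y n : set X := pi_character_le (A n).
have [nowhere_dense|] := pselect (forall n U, open U -> U !=set0 ->
    ~ (U `<=` closure (Y n))).
  have [iota iotaP] := clopen_columns X_acc hX3 e_surj X_crowded openT X0.
  have /choice[V hV] : forall n, exists V, [/\ clopen V, V !=set0
      & V `<=` iota @^-1` [set n] `\` closure (Y n)].
    move=> n; have [oi [x [ix _]]] := iotaP n.
    apply: (clopen_in_open hX3 e_surj).
      by rewrite setDE; apply: openI => //; rewrite openC; exact: closed_closure.
    apply: contrapT => nV; apply: (nowhere_dense n _ oi); first by exists x.
    by move=> y iy; apply: contrapT => nYy; apply: nV; exists y.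
  have [lt [wo seg]] : exists lt : set X -> set X -> Prop, well_order lt /\
      forall D, [set E | lt E D] #<= [set: {n & A n}].
    apply: (aleph_omega_succ_order A_aleph W_aleph K_aleph).
    apply: card_le_trans cK.
    (* A subset of [X] is determined by its trace on the enumeration, so there are at most continuum
       many. *)
    apply: (@card_le_of_inj _ _ _ _ (fun D n => `[< D (e n) >])) => //.
    move=> D D' _ _ DD'.
    have DDn n : `[< D (e n) >] = `[< D' (e n) >] := congr1 (@^~ n) DD'.
    apply/seteqP; split=> x; have [n <-] := e_surj x => /asboolP.
      by rewrite DDn => /asboolP.
    by rewrite -DDn => /asboolP.
  apply: (transfinite_far_assignment hX3 e_surj
    (iota := iota) (V := V) (A := A) _ _ _ _ _ _ _ wo seg).
  - by move=> n; case: (iotaP n).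
  - by move=> n; case: (hV n).
  - by move=> n; case: (hV n).
  - by move=> n; have [_ _ VY] := hV n => x /VY[].
  - by move=> n; exact: aleph_infinite.
  - by move=> m n; exact: aleph_le.
  - move=> n x Vx; apply: contrapT => Yx; have [_ _ /(_ x Vx)[_ nY]] := hV n.
    by apply: nY; exact: subset_closure.
move=> /existsNP[n0 dense0].
have ex_dense : exists n, `[< exists U, [/\ open U, U !=set0 & U `<=` closure (Y n)] >].
  exists n0; apply/asboolP; move: dense0 => /existsNP[U /not_implyP[oU]].
  by move=> /not_implyP[U0 /contrapT UY]; exists U.
case: (ex_minnP ex_dense) => n /asboolP[U [oU U0 UY]] n_min.
(* By minimality of [n = m.+1], the points of pi-character at most aleph_m are not dense in [U], and
   [U'] omits their closure. For [n = 0], finite families are avoidable everywhere. *)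
have [U' [oU' U'0 U'U U'_avoid]] : exists U', [/\ open U', U' !=set0, U' `<=` U
    & forall (S : Type) (B : set S) x, U' x ->
      (if n is m.+1 then B #<= [set: A m] else finite_set B) -> avoidable B x].
  case: n => [|m] in UY n_min *.
    exists U; split=> // S B x _; exact: (avoidable_finite X_acc X_crowded).
  exists (U `\` closure (Y m)); split.
  - by rewrite setDE; apply: openI => //; rewrite openC; exact: closed_closure.
  - apply: contrapT => nU; have := n_min m; rewrite ltnn => h.
    have : false; last by [].
    apply: h; apply/asboolP; exists U; split=> // x Ux.
    by apply: contrapT => nYx; apply: nU; exists x.
  - by move=> x [].
  - move=> S B x [_ nYx] Bm; have xm : avoidable [set: A m] x.
      by apply: contrapT => Yx; apply: nYx; exact: subset_closure.
    by apply: avoidable_card_le Bm xm; apply: infinite_setN0; exact: aleph_infinite.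
have [lt [wo seg bound]] := aleph_regular_order A_aleph n.
have [b [ob bP]] := dense_pi_character_pi_base e_surj
  (aleph_infinite A_aleph (n := n)) (subset_trans U'U UY).
apply: (pi_base_far_assignment X_acc hX3 e_surj X_crowded wo oU' U'0 ob) => //.
by move=> i x U'x; exact: U'_avoid U'x (seg i).
Qed.
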